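(* Consider a positive definite Hermitian matrix system with control input $u=(u^1,u^2,\ldots,u^m)$, output $A(u)\in P(n)$ and target matrix $B\in\mathcal{M}$, where $\mathcal{M}=\{A(u)\mid u\in\Theta\subset\mathbb{R}^m\}$ is the output submanifold of $P(n)$. For the control input $u$ of this system, the iterative formula of the Riemannian gradient descent algorithm for the cost function $J(u)=d^2(A(u),B)$ is given by $$A(u_{k+1})=A^{\frac12}(u_k)\exp\left\{-\eta_k\ln\left(A^{-\frac12}(u_k)\,B\,A^{-\frac12}(u_k)\right)\right\}A^{\frac12}(u_k),$$ where $\eta_k$ is the learning rate at time $k$.
   Context: $P(n)$ is the manifold of $n\times n$ positive definite Hermitian complex matrices, with Riemannian metric $g_A(X,Y)=\operatorname{tr}(A^{-1}XA^{-1}Y)$ for $X,Y$ in the tangent space $T_AP(n)$. Its geodesic distance is $d(A,B)=\|\ln(A^{-1/2}BA^{-1/2})\|_F$, where $\|\cdot\|_F$ is the Frobenius norm, and $\exp$ and $\ln$ are the matrix exponential and logarithm. The system is a map $u\mapsto A(u)\in P(n)$ whose output depends only on the control input $u$; it is assumed to be such that $\mathcal{M}$ is a submanifold of $P(n)$ on which $u$ plays the role of local coordinates. The control problem is to find $u_*=\arg\min_u J(u)$, i.e. to make the output $A(u)$ as close as possible to the target $B$. The Riemannian gradient descent algorithm takes the negative gradient of $J$ about $A(u)$ as the direction at $A(u_k)$, and moves from $A(u_k)$ along the geodesic of $P(n)$ in that direction, with step governed by the learning rate $\eta_k$; $u_k$ denotes the input at time $k$.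
   Formalization: As printed the formula moves away from the target B when the learning rate is positive (sign error in the logarithm); the formal version keeps the formula but takes the geodesic time along the negative gradient to be minus half the learning rate, so descent steps have negative learning rate. *)

(* Defs.v *)
From HB Require Import structures.
From mathcomp Require Import all_boot all_order all_algebra.
From mathcomp Require Import spectral complex.
From mathcomp Require Import all_classical all_reals all_analysis.

Set Implicit Arguments.
Unset Strict Implicit.
Unset Printing Implicit Defensive.

Import Order.TTheory GRing.Theory Num.Theory.
Import numFieldNormedType.Exports.

Local Open Scope classical_set_scope.
Local Open Scope sesquilinear_scope.
Local Open Scope complex_scope.
Local Open Scope ring_scope.

(* R[i] carries no real normed structure in the library, so limits,
   derivatives and open sets of complex matrices are taken through this real
   linear isomorphism, X |-> (Re X | Im X). *)
Definition realify (R : realType) (n : nat) (X : 'M[R[i]]_n) :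
    'M[R]_(n, n + n) :=
  row_mx (map_mx (@complex.Re R) X) (map_mx (@complex.Im R) X).

Definition unrealify (R : realType) (n : nat) (p : 'M[R]_(n, n + n)) :
    'M[R[i]]_n :=
  \matrix_(i, j) (lsubmx p i j +i* rsubmx p i j).

Definition posdefmx (R : realType) (n : nat) (S : 'M[R[i]]_n) : Prop :=
  S \is hermsymmx /\
  forall v : 'cV[R[i]]_n, v != 0 -> 0 < (v ^t* *m S *m v) ord0 ord0.

Definition expmx (R : realType) (n : nat) (X : 'M[R[i]]_n) : 'M[R[i]]_n :=
  unrealify (limn (fun N : nat =>
    realify (\sum_(k < N) ((k`!)%:R : R[i])^-1 *: X ^+ k))).

(* The logarithm of a positive definite S is the unique Hermitian X with
   exp X = S. *)
Definition lnmx (R : realType) (n : nat) (S : 'M[R[i]]_n) : 'M[R[i]]_n :=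
  xget 0 [set X : 'M[R[i]]_n | X \is hermsymmx /\ expmx X = S].

(* The square root of a positive definite S is its unique positive definite
   square root. *)
Definition sqrtmx (R : realType) (n : nat) (S : 'M[R[i]]_n) : 'M[R[i]]_n :=
  xget 0 [set X : 'M[R[i]]_n | posdefmx X /\ X *m X = S].

Definition invsqrtmx (R : realType) (n : nat) (S : 'M[R[i]]_n) : 'M[R[i]]_n :=
  invmx (sqrtmx S).

Definition frobenius_norm (R : realType) (n : nat) (X : 'M[R[i]]_n) : R :=
  Num.sqrt (\sum_i \sum_j
    (complex.Re (X i j) ^+ 2 + complex.Im (X i j) ^+ 2)).

Definition pd_dist (R : realType) (n : nat) (S T : 'M[R[i]]_n) : R :=
  frobenius_norm (lnmx (invsqrtmx S *m T *m invsqrtmx S)).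

(* The tangent space of P(n) at every point is the real vector space of
   Hermitian matrices; the trace below is real for Hermitian X, Y. *)
Definition pd_metric (R : realType) (n : nat) (S X Y : 'M[R[i]]_n) : R :=
  complex.Re (\tr (invmx S *m X *m invmx S *m Y)).

Definition curve_derive (R : realType) (n : nat) (c : R -> 'M[R[i]]_n)
    (t : R) (V : 'M[R[i]]_n) : Prop :=
  is_derive t (1 : R) (fun s => realify (c s)) (realify V).

(* V is the Riemannian gradient at S of a function F on P(n):
   g_S(V, X) = dF_S(X) for every tangent vector X. *)
Definition is_pd_gradient (R : realType) (n : nat) (F : 'M[R[i]]_n -> R)
    (S V : 'M[R[i]]_n) : Prop :=
  V \is hermsymmx /\
  forall X : 'M[R[i]]_n, X \is hermsymmx ->
    is_derive (0 : R) (1 : R) (fun s : R => F (S + s%:C *: X))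
      (pd_metric S V X).

(* Geodesic equation of the Levi-Civita connection, with index lowered, in
   the global chart given by the inclusion of P(n) into the Hermitian
   matrices:
     d/dt g_c(c', Z) = 1/2 (D_Z g)_c(c', c')  for all constant fields Z. *)
Definition is_pd_geodesic (R : realType) (n : nat) (c : R -> 'M[R[i]]_n) :
    Prop :=
  (forall t, posdefmx (c t)) /\
  exists c1 c2 : R -> 'M[R[i]]_n,
    [/\ forall t, curve_derive c t (c1 t),
        forall t, curve_derive c1 t (c2 t) &
        forall (t : R) (Z : 'M[R[i]]_n), Z \is hermsymmx ->
          derive1 (fun s : R => pd_metric (c s) (c1 s) Z) t =
          2^-1 *
          derive1 (fun s : R => pd_metric (c t + s%:C *: Z) (c1 t) (c1 t)) 0].

Fixpoint Ck_on (R : realType) (V W : normedModType R) (k : nat) (D : set V)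
    (f : V -> W) : Prop :=
  (forall x, D x -> {for x, continuous f}) /\
  (if k is k'.+1 then
     forall v, (forall x, D x -> derivable f x v) /\
               Ck_on k' D (fun x => 'D_v f x)
   else True).

(* A is a smooth immersion of the open set Theta into P(n) which is open onto
   its image M = A(Theta) (for the subspace topology): M is then an embedded
   submanifold of P(n) for which u is a local coordinate system. *)
Definition output_system (R : realType) (m n : nat) (Theta : set 'rV[R]_m)
    (A : 'rV[R]_m -> 'M[R[i]]_n) : Prop :=
  [/\ open Theta,
      forall v, Theta v -> posdefmx (A v),
      forall k, Ck_on k Theta (fun v => realify (A v)),
      forall v w, Theta v -> 'D_w (fun v' => realify (A v')) v = 0 -> w = 0 &
      forall U : set 'rV[R]_m, open U -> U `<=` Theta ->
        exists2 O : set 'M[R]_(n, n + n), open O &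
          A @` U = (A @` Theta) `&` [set S | O (realify S)]].

(* The cost as a function of the output: J(u) = output_cost B (A u). *)
Definition output_cost (R : realType) (n : nat) (B S : 'M[R[i]]_n) : R :=
  pd_dist S B ^+ 2.

(* T is reached from S by following, for time t, the geodesic of P(n) issued
   from S with initial velocity minus the gradient of F at S. *)
Definition riemannian_gradient_step (R : realType) (n : nat)
    (F : 'M[R[i]]_n -> R) (t : R) (S T : 'M[R[i]]_n) : Prop :=
  exists (V : 'M[R[i]]_n) (c : R -> 'M[R[i]]_n),
    [/\ is_pd_gradient F S V, is_pd_geodesic c, c 0 = S,
        curve_derive c 0 (- V) & T = c t].

(* t k is the geodesic time travelled at step k. *)
Definition riemannian_gradient_descent (R : realType) (m n : nat)
    (A : 'rV[R]_m -> 'M[R[i]]_n) (B : 'M[R[i]]_n) (t : nat -> R)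
    (u : nat -> 'rV[R]_m) : Prop :=
  forall k, riemannian_gradient_step (output_cost B) (t k)
              (A (u k)) (A (u k.+1)).

(* Main.v *)
Require Import Defs.
From HB Require Import structures.
From mathcomp Require Import all_boot all_order all_algebra.
From mathcomp Require Import spectral complex.
From mathcomp Require Import ring lra.
From mathcomp Require Import all_classical all_reals all_analysis.

Set Implicit Arguments.
Unset Strict Implicit.
Unset Printing Implicit Defensive.

Import Order.TTheory GRing.Theory Num.Theory.
Import numFieldNormedType.Exports.

Local Open Scope classical_set_scope.
Local Open Scope sesquilinear_scope.
Local Open Scope complex_scope.
Local Open Scope ring_scope.

(* Write [S = A(u_k)] and choose an invertible [N] with [S = N x N^*] and
   [B = N N^*], [x] a positive diagonal matrix; every function of [S] and [B] in
   the statement then becomes diagonal in a suitable basis.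

   Gradient: [d^2(S, B)] is the sum of [ln^2 x_i].  For [S + s X] it is the sum
   of [ln^2 y_j], where [y] is the spectrum of [x + s Z], [Z = N^-1 X N^-*].  If
   the unitary [W] diagonalises [x + s Z], the weights [|W_ij|^2] are doubly
   stochastic and average the scalar Taylor estimate of [ln^2] at [x_i] into
   [|F(S + s X) - F(S) - s sum_i 2 ln(x_i) Z_ii / x_i| <= K s^2 tr(Z^2)], so
   perturbation theory of eigenvalues is not needed.

   Geodesics: as [tr(W Z)] is nondegenerate on Hermitian matrices, the geodesic
   equation says [c'' = c' c^-1 c'], i.e. [(c^-1 c')' = 0].  Hence [c' = c G]
   with [G] constant, and a geodesic is determined by [c(0)] and [c'(0)]; the
   curve [M e^(t k) M^*], [k] diagonal, is one. *)

(** * Congruences, trace identities and unitary diagonalisation *)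

(* Kept over an abstract field: rewriting with [mulmxA] directly over [R[i]] is
   slowed down a hundredfold by conversion problems on ring structures. *)
Section MatrixAlgebra.
Variables (C : numClosedFieldType) (n : nat).
Implicit Types (N H G U V W X Z D E I S : 'M[C]_n).

Lemma adjmxM m p q (X : 'M[C]_(m, p)) (Z : 'M[C]_(p, q)) :
  (X *m Z)^t* = Z^t* *m X^t*.
Proof. by rewrite trmx_mul map_mxM. Qed.

Lemma adjmx_unit N : (N^t* \in unitmx) = (N \in unitmx).
Proof. by rewrite map_unitmx unitmx_tr. Qed.

Lemma herm_congr N X : X^t* = X -> (N *m X *m N^t*)^t* = N *m X *m N^t*.
Proof. by move=> Xh; rewrite !adjmxM trmxCK Xh mulmxA. Qed.

Lemma invmx_adj N : N \in unitmx -> (invmx N)^t* = invmx (N^t*).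
Proof. by move=> Nu; rewrite trmx_inv map_invmx. Qed.

Lemma invmxM N H : N \in unitmx -> H \in unitmx ->
  invmx (N *m H) = invmx H *m invmx N.
Proof.
move=> Nu Hu; have NHu : N *m H \in unitmx by rewrite unitmx_mul Nu.
apply: (can_inj (mulmxK NHu)).
by rewrite mulVmx// mulmxA -(mulmxA _ (invmx N)) mulVmx// mulmx1 mulVmx.
Qed.

Lemma herm_inv S : S \in unitmx -> S^t* = S -> (invmx S)^t* = invmx S.
Proof. by move=> Su Sh; rewrite invmx_adj// Sh. Qed.

Lemma herm_sandwich S X : S^t* = S -> X^t* = X ->
  (S *m X *m S)^t* = S *m X *m S.
Proof. by move=> Sh Xh; rewrite !adjmxM Sh Xh mulmxA. Qed.

Lemma herm_sub X Z : X^t* = X -> Z^t* = Z -> (X - Z)^t* = X - Z.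
Proof. by move=> Xh Zh; rewrite linearB /= map_mxB Xh Zh. Qed.

Lemma herm_line X Z (s : C) : Num.conj s = s -> X^t* = X -> Z^t* = Z ->
  (X + s *: Z)^t* = X + s *: Z.
Proof.
by move=> sr Xh Zh; rewrite linearD linearZ /= map_mxD map_mxZ /= sr Xh Zh.
Qed.

Lemma sandwich_eq0 S X : S \in unitmx ->
  invmx S *m X *m invmx S = 0 -> X = 0.
Proof.
move=> Su /(congr1 (fun Z => S *m Z *m S)).
by rewrite mulmx0 mul0mx !mulmxA mulmxV// mul1mx mulmxKV.
Qed.

Lemma congr_comp N W D :
  N *m (W *m D *m W^t*) *m N^t* = (N *m W) *m D *m (N *m W)^t*.
Proof. by rewrite adjmxM !mulmxA. Qed.

Lemma congr_unitary N W : W *m W^t* = 1%:M ->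
  (N *m W) *m (N *m W)^t* = N *m N^t*.
Proof. by move=> WW; rewrite adjmxM mulmxA -(mulmxA N) WW mulmx1. Qed.

Lemma congr_cancel N X : N \in unitmx ->
  N *m (invmx N *m X *m (invmx N)^t*) *m N^t* = X.
Proof.
move=> Nu; rewrite invmx_adj// !mulmxA mulmxV// mul1mx mulmxKV//.
by rewrite adjmx_unit.
Qed.

Lemma congr_line N D X (s : C) : N \in unitmx ->
  N *m D *m N^t* + s *: X =
  N *m (D + s *: (invmx N *m X *m (invmx N)^t*)) *m N^t*.
Proof.
by move=> Nu; rewrite mulmxDr mulmxDl -scalemxAr -scalemxAl congr_cancel.
Qed.

(** Invariance of the metric under congruence: [N] cancels by cyclicity of the trace, and [X] is
    pulled back to [N^-1 X N^-*]. *)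
Lemma tr_congr N D Di V X : N \in unitmx -> D *m Di = 1%:M ->
  \tr (invmx (N *m D *m N^t*) *m (N *m V *m N^t*) *m
       invmx (N *m D *m N^t*) *m X) =
  \tr (Di *m V *m Di *m (invmx N *m X *m (invmx N)^t*)).
Proof.
move=> Nu DDi; have [Du Diu] := mulmx1_unit DDi.
have Nu' : N^t* \in unitmx by rewrite adjmx_unit.
have -> : Di = invmx D by rewrite -[Di](mulKmx Du) DDi mulmx1.
rewrite !invmxM ?unitmx_mul ?Nu ?Du// invmx_adj//.
rewrite !mulmxA !mulmxKV// -!mulmxA mxtrace_mulC -!mulmxA.
by rewrite !mulmxA !mulmxK// -!mulmxA.
Qed.

(* [U = S^(-1/2) N D^(1/2)] with [S = N D N^t*], [H = S^(1/2)],
   [Q = D^(1/2)] and [P = Q^-1]. *)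
Lemma polar_unitary N H Q P : N \in unitmx -> H \in unitmx ->
  H^t* = H -> Q^t* = Q -> P^t* = P -> Q *m P = 1%:M ->
  H *m H = N *m (Q *m Q) *m N^t* ->
  exists U, [/\ U *m U^t* = 1%:M, H *m U = N *m Q &
    invmx H *m (N *m N^t*) *m invmx H = U *m (P *m P) *m U^t*].
Proof.
move=> Nu Hu Hh Qh Ph QP HH; exists (invmx H *m N *m Q).
have Hih := herm_inv Hu Hh; have PQ := mulmx1C QP.
split.
- rewrite !adjmxM Hih Qh.
  have -> : invmx H *m N *m Q *m (Q *m (N^t* *m invmx H)) =
      invmx H *m (N *m (Q *m Q) *m N^t*) *m invmx H by rewrite !mulmxA.
  by rewrite -HH (mulKmx Hu) mulmxV.
- by rewrite !mulmxA mulmxV// mul1mx.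
rewrite !adjmxM Hih Qh !mulmxA -(mulmxA _ Q P) QP mulmx1.
by rewrite -(mulmxA _ P Q) PQ mulmx1.
Qed.

Definition linear_form I W Z := \tr (I *m W *m I *m Z).

(** The metric pairing of [V I V] with [Z]; up to sign, [V I V] is the Christoffel term of the
    geodesic equation. *)
Definition quadratic_form I V Z := \tr (I *m V *m I *m V *m I *m Z).

Lemma mxtrace_cyc6 I V Z :
  \tr (I *m Z *m I *m V *m I *m V) = \tr (I *m V *m I *m V *m I *m Z).
Proof.
rewrite -!mulmxA mxtrace_mulC -!mulmxA mxtrace_mulC -!mulmxA.
by rewrite mxtrace_mulC -!mulmxA mxtrace_mulC -!mulmxA.
Qed.

(* The left-hand side is the product rule for [tr (c^-1 c' c^-1 Z)], with
   [I = c^-1], [V = c'] and [W = c'']. *)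
Lemma metric_variation I V W Z :
  \tr (((- (I *m V *m I) *m V + I *m W) *m I +
        I *m V *m (- (I *m V *m I))) *m Z + I *m V *m I *m 0) =
  linear_form I W Z - quadratic_form I V Z *+ 2.
Proof.
rewrite /linear_form /quadratic_form mulmx0 addr0 !mulmxDl mulmxN !mulNmx.
rewrite !mulmxA.
by rewrite !raddfD !raddfN /=; ring.
Qed.

(* Likewise for [tr (c^-1 V c^-1 V)] along [c = S + s Z], with [I = S^-1]. *)
Lemma metric_line_variation I V Z :
  \tr (((- (I *m Z *m I) *m V + I *m 0) *m I +
        I *m V *m (- (I *m Z *m I))) *m V + I *m V *m I *m 0) =
  - quadratic_form I V Z *+ 2.
Proof.
rewrite /quadratic_form !mulmx0 !addr0 mulmxN !mulmxDl !mulNmx !mulmxA.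
rewrite !raddfD !raddfN /= mxtrace_cyc6.
rewrite -(mulmxA (I *m V *m I *m Z)) (mxtrace_mulC (I *m V *m I *m Z)).
by rewrite !mulmxA; ring.
Qed.

Lemma metric_acceleration I V W Z :
  \tr (I *m (W - V *m I *m V) *m I *m Z) =
  linear_form I W Z - quadratic_form I V Z.
Proof.
by rewrite /linear_form /quadratic_form mulmxBr !mulmxBl raddfB /= !mulmxA.
Qed.

Lemma metric_acceleration0 I V W Z : W = V *m I *m V ->
  \tr (I *m (W - V *m I *m V) *m I *m Z) = 0.
Proof. by move=> ->; rewrite subrr mulmx0 !mul0mx mxtrace0. Qed.

(** Both sides of [c'' = c' c^-1 c'] transform alike under congruence, so the equation can be
    checked on the inner factors. *)
Lemma congr_acceleration N D Di E : N \in unitmx -> D *m Di = 1%:M ->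
  N *m E *m N^t* *m invmx (N *m D *m N^t*) *m (N *m E *m N^t*) =
  N *m (E *m Di *m E) *m N^t*.
Proof.
move=> Nu DDi; have [Du _] := mulmx1_unit DDi.
have Nu' : N^t* \in unitmx by rewrite adjmx_unit.
have -> : Di = invmx D by rewrite -[Di](mulKmx Du) DDi mulmx1.
rewrite !invmxM ?unitmx_mul ?Nu ?Du// !mulmxA mulmxK//.
by rewrite mulmxKV.
Qed.

(** Product rule for [c^-1 c'], with [I = c^-1], [V = c'] and [c''] replaced by [V I V]. *)
Lemma velocity_variation I V : - (I *m V *m I) *m V + I *m (V *m I *m V) = 0.
Proof. by rewrite mulNmx !mulmxA addNr. Qed.

(** Product rule for [c e^-1], with [X = c], [S = e], [c' = c G] and [e' = e G]. *)
Lemma ratio_variation S X G : S \in unitmx ->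
  X *m G *m invmx S + X *m (- (invmx S *m (S *m G) *m invmx S)) = 0.
Proof. by move=> Su; rewrite mulKmx// mulmxN mulmxA subrr. Qed.

Lemma congr_opp N D : N *m (- D) *m N^t* = - (N *m D *m N^t*).
Proof. by rewrite mulmxN mulNmx. Qed.

Lemma hermP X : reflect (X^t* = X) (X \is hermsymmx).
Proof.
by apply: (iffP (is_hermitianmxP _ _ _)); rewrite expr0 scale1r => /esym.
Qed.

(** Hermitian matrices have real eigenvalues, so over [R[i]] these can be taken in [R]: there [f] is
    the embedding and [g] the real part. *)
Lemma herm_spectral_diag (K : Type) (f : K -> C) (g : C -> K) X :
  (forall z, z \is Num.real -> f (g z) = z) -> X \is hermsymmx ->
  exists U (x : 'I_n -> K),
    U *m U^t* = 1%:M /\ X = U *m diag_mx (\row_j f (x j)) *m U^t*.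
Proof.
move=> fg hX; have /orthomx_spectralP XE := hermitian_normalmx hX.
have /mxOverP rD := hermitian_spectral_diag_real hX.
have /unitarymxP Pu := spectral_unitarymx X.
exists ((spectralmx X)^t*), (fun j => g (spectral_diag X ord0 j)).
rewrite trmxCK; split; first exact: mulmx1C.
rewrite (_ : \row_j _ = spectral_diag X).
  by rewrite {1}XE invmx_unitary ?spectral_unitarymx.
by apply/rowP => j; rewrite mxE fg.
Qed.

(* The matrix [W = U^t* V] intertwines [d] and [e], so [W i j = 0] unless
   [d i = e j]; hence it intertwines [d'] and [e']. *)
Lemma spectral_map_diag U V (d e d' e' : 'rV[C]_n) :
  U *m U^t* = 1%:M -> V *m V^t* = 1%:M ->
  (forall i j, d ord0 i = e ord0 j -> d' ord0 i = e' ord0 j) ->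
  U *m diag_mx d *m U^t* = V *m diag_mx e *m V^t* ->
  U *m diag_mx d' *m U^t* = V *m diag_mx e' *m V^t*.
Proof.
move=> UU VV de E; have UU' := mulmx1C UU; have VV' := mulmx1C VV.
have {}E : diag_mx d *m (U^t* *m V) = U^t* *m V *m diag_mx e.
  have : U^t* *m (U *m diag_mx d *m U^t*) *m V =
         U^t* *m (V *m diag_mx e *m V^t*) *m V by rewrite E.
  by rewrite !mulmxA UU' mul1mx => ->; rewrite -!mulmxA VV' mulmx1.
have {}E : diag_mx d' *m (U^t* *m V) = U^t* *m V *m diag_mx e'.
  apply/matrixP => i j; move/matrixP : E => /(_ i j).
  have lE (f : 'rV[C]_n) X : (diag_mx f *m X) i j = f ord0 i * X i j.
    by rewrite mul_diag_mx mxE.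
  have rE (f : 'rV[C]_n) X : (X *m diag_mx f) i j = X i j * f ord0 j.
    by rewrite mul_mx_diag mxE.
  rewrite !lE !rE.
  have [->|W0] := eqVneq ((U^t* *m V) i j) 0; first by rewrite !mulr0 !mul0r.
  by rewrite [LHS]mulrC => /(mulfI W0) /de ->; rewrite mulrC.
have : U *m (diag_mx d' *m (U^t* *m V)) *m V^t* =
       U *m (U^t* *m V *m diag_mx e') *m V^t* by rewrite E.
by rewrite !mulmxA UU mul1mx => <-; rewrite -!mulmxA VV mulmx1.
Qed.
End MatrixAlgebra.

(** * Functional calculus for Hermitian matrices *)

Section HermitianCalculus.
Variables (R : realType) (n : nat).
Local Notation C := R[i].
Implicit Types (X Y S U V N : 'M[C]_n) (x y : 'I_n -> R).

Definition dg x : 'M[C]_n := diag_mx (\row_j (x j)%:C).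

Lemma conjCE (z : C) : Num.conj z = conjc z.
Proof. by []. Qed.

Lemma dg_adj x : (dg x)^t* = dg x.
Proof.
apply/matrixP => i j; rewrite !mxE eq_sym.
by case: eqP => [->|_]; rewrite ?mulr1n ?mulr0n conjCE ?conjc_real ?conjc0.
Qed.

Lemma dgM x y : dg x *m dg y = dg (fun i => x i * y i).
Proof.
rewrite /dg mulmx_diag; congr diag_mx; apply/rowP => j.
by rewrite !mxE rmorphM.
Qed.

Lemma dg1 : dg (fun=> 1) = 1%:M.
Proof.
rewrite -diag_const_mx /dg; congr diag_mx; apply/rowP => j.
by rewrite !mxE rmorph1.
Qed.

Lemma eq_dg x y : x =1 y -> dg x = dg y.
Proof. by move=> /funext ->. Qed.

Lemma dgVr x : (forall i, x i != 0) -> dg x *m dg (fun i => (x i)^-1) = 1%:M.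
Proof.
by move=> x0; rewrite dgM -dg1; apply: eq_dg => i; rewrite divff.
Qed.

Lemma herm_spectral X : X \is hermsymmx ->
  exists U x, U *m U^t* = 1%:M /\ X = U *m dg x *m U^t*.
Proof. exact: herm_spectral_diag (@RRe_real R). Qed.
End HermitianCalculus.

(** * Square root, exponential and logarithm through eigenvalues *)

Section SpectralFunctions.
Variables (R : realType) (n : nat).
Local Notation C := R[i].
Implicit Types (X Y S U V N : 'M[C]_n) (x y : 'I_n -> R).

Lemma dg_mul x m (X : 'M[C]_(n, m)) i j : (dg x *m X) i j = (x i)%:C * X i j.
Proof. by rewrite mul_diag_mx !mxE. Qed.

Lemma mul_dg x m (X : 'M[C]_(m, n)) i j : (X *m dg x) i j = X i j * (x j)%:C.
Proof. by rewrite mul_mx_diag !mxE. Qed.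

(** Well-definedness of [f(X)]: it does not depend on the diagonalisation chosen for [X]. *)
Lemma spectral_map (f : R -> R) U V x y :
  U *m U^t* = 1%:M -> V *m V^t* = 1%:M ->
  U *m dg x *m U^t* = V *m dg y *m V^t* ->
  U *m dg (f \o x) *m U^t* = V *m dg (f \o y) *m V^t*.
Proof.
move=> UU VV; apply: spectral_map_diag => // i j.
by rewrite !mxE => -[xy]; rewrite /= xy.
Qed.

Lemma unitary_unit U : U *m U^t* = 1%:M -> U \in unitmx.
Proof. by case/mulmx1_unit. Qed.

Lemma dg_unit x : (forall i, x i != 0) -> dg x \in unitmx.
Proof. by move=> /dgVr/mulmx1_unit[]. Qed.

(** With [w = N^* v], which is nonzero, the quadratic form is the sum of [x_i |w_i|^2]. *)
Lemma posdef_congr N x : N \in unitmx -> (forall i, 0 < x i) ->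
  posdefmx (N *m dg x *m N^t*).
Proof.
move=> Nu x0; split; first by apply/hermP/herm_congr; exact: dg_adj.
move=> v v0; set w := N^t* *m v.
have -> : v^t* *m (N *m dg x *m N^t*) *m v = w^t* *m (dg x *m w).
  by rewrite /w adjmxM trmxCK !mulmxA.
have w0 : w != 0.
  have Nu' : N^t* \in unitmx by rewrite adjmx_unit.
  by apply: contra v0 => /eqP w0; rewrite -(mulKmx Nu' v) -/w w0 mulmx0.
rewrite mxE.
have pos i : w^t* ord0 i * (dg x *m w) i ord0 = (x i)%:C * `|w i ord0| ^+ 2.
  by rewrite dg_mul !mxE normCK mulrCA [Num.conj _ * _]mulrC.
have /cV0Pn[i wi0] := w0.
rewrite (bigD1 i)//= ltr_wpDr//.
  by apply: sumr_ge0 => j _; rewrite pos mulr_ge0 ?exprn_ge0// ler0c ltW.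
by rewrite pos mulr_gt0 ?exprn_gt0 ?normr_gt0// ltcR.
Qed.

Lemma posdef_spectral S : posdefmx S -> exists U x,
  [/\ U *m U^t* = 1%:M, forall i, 0 < x i & S = U *m dg x *m U^t*].
Proof.
move=> [/herm_spectral[U [x [UU SE]]] pos]; exists U, x; split => // i.
have UU' := mulmx1C UU.
(* On the [i]-th eigenvector the quadratic form takes the value [x i]. *)
have v0 : U *m delta_mx i ord0 != 0 :> 'cV_n.
  apply/eqP => /(congr1 (mulmx (U^t*))); rewrite mulmx0 mulmxA UU' mul1mx.
  by move/matrixP => /(_ i ord0); rewrite !mxE !eqxx => /eqP; rewrite oner_eq0.
have := pos _ v0.
rewrite SE adjmxM !mulmxA -(mulmxA _ (U^t*) U) UU' mulmx1.
rewrite -(mulmxA _ (U^t*) U) UU' mulmx1 -mulmxA mxE (bigD1 i)//= big1 ?addr0.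
  rewrite dg_mul !mxE !eqxx mulr1n mulr1 conjCE conjc1 mul1r.
  by rewrite ltcR.
by move=> j ji; rewrite !mxE (negPf ji)/= conjCE conjc0 mul0r.
Qed.

Lemma posdef_unit S : posdefmx S -> S \in unitmx.
Proof.
case/posdef_spectral => U [x [UU x0 ->]].
rewrite !unitmx_mul adjmx_unit unitary_unit// dg_unit// => i.
by rewrite gt_eqF.
Qed.

Lemma posdef_herm S : posdefmx S -> S^t* = S.
Proof. by case=> /hermP. Qed.

(** [xget] meets its specification once a witness exists: keep the eigenvectors and take roots of
    the eigenvalues. *)
Lemma sqrtmxP S : posdefmx S ->
  posdefmx (sqrtmx S) /\ sqrtmx S *m sqrtmx S = S.
Proof.
case/posdef_spectral => U [x [UU x0 SE]].
apply: (@xgetI _ 0 [set X | posdefmx X /\ X *m X = S]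
  (U *m dg (fun i => Num.sqrt (x i)) *m U^t*)); split.
  apply: posdef_congr; first exact: unitary_unit.
  by move=> i; rewrite sqrtr_gt0.
rewrite !mulmxA -(mulmxA _ (U^t*) U) (mulmx1C UU) mulmx1.
rewrite -(mulmxA U) dgM SE; congr (_ *m _ *m _); apply: eq_dg => i.
by rewrite -expr2 sqr_sqrtr// ltW.
Qed.

(** The squared norm is the real part of [tr X X^*], from which [U] disappears by cyclicity. *)
Lemma frobenius_spectral U x : U *m U^t* = 1%:M ->
  frobenius_norm (U *m dg x *m U^t*) ^+ 2 = \sum_i x i ^+ 2.
Proof.
move=> UU; rewrite /frobenius_norm sqr_sqrtr; last first.
  by apply: sumr_ge0 => i _; apply: sumr_ge0 => j _; rewrite addr_ge0 ?sqr_ge0.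
set X := U *m dg x *m U^t*.
have -> : \sum_i x i ^+ 2 = complex.Re (\tr (X *m X^t*)).
  have -> : X *m X^t* = U *m (dg x *m dg x) *m U^t*.
    rewrite /X herm_congr ?dg_adj// !mulmxA -(mulmxA _ (U^t*) U) (mulmx1C UU).
    by rewrite mulmx1.
  rewrite mxtrace_mulC dgM mulmxA (mulmx1C UU) mul1mx mxtrace_diag.
  rewrite raddf_sum; apply: eq_bigr => i _.
  by rewrite mxE expr2.
rewrite /mxtrace raddf_sum/=; apply: eq_bigr => i _.
rewrite mxE raddf_sum; apply: eq_bigr => j _.
rewrite [X^t* _ _]mxE [X^T _ _]mxE conjCE; case: (X i j) => a b /=; ring.
Qed.

Lemma realify_limn (u : nat -> 'M[C]_n) X :
  realify (u k) @[k --> \oo] --> realify X ->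
  unrealify (limn (fun k => realify (u k))) = X.
Proof.
move=> /cvg_lim -> //; apply/matrixP => i j.
rewrite !mxE /= (unsplitK (inl j)) (unsplitK (inr j)) !mxE.
by case: (X i j).
Qed.

Lemma realifyE X i j : realify X i j =
  match fintype.split j with
  | inl k => complex.Re (X i k)
  | inr k => complex.Im (X i k)
  end.
Proof. by rewrite mxE; case: fintype.split => k; rewrite mxE. Qed.

(** Real-linearity in the eigenvalues, with fixed matrix coefficients, turns scalar limits into
    matrix limits. *)
Lemma realify_spectral U x : realify (U *m dg x *m U^t*) =
  \sum_i x i *: realify (U *m delta_mx i i *m U^t*).
Proof.
have -> : U *m dg x *m U^t* = \sum_i (x i)%:C *: (U *m delta_mx i i *m U^t*).
  rewrite /dg diag_mx_sum_delta mulmx_sumr mulmx_suml; apply: eq_bigr => i _.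
  by rewrite mxE -scalemxAr -scalemxAl.
have scaleE (c : C) Y i j : (c *: Y) i j = c * Y i j by rewrite mxE.
apply/matrixP => i j; rewrite summxE realifyE.
have rscaleE (a : R) Y : (a *: realify Y) i j = a * realify Y i j.
  by rewrite [LHS]mxE.
under [RHS]eq_bigr do rewrite rscaleE realifyE.
case: fintype.split => k; rewrite summxE raddf_sum; apply: eq_bigr => l _;
  rewrite scaleE; case: ((_ *m _) i k) => a b /=; ring.
Qed.

Lemma spectralX U x k : U *m U^t* = 1%:M ->
  (U *m dg x *m U^t*) ^+ k = U *m dg (fun i => x i ^+ k) *m U^t*.
Proof.
move=> UU; elim: k => [|k IH].
  by rewrite expr0 (_ : dg _ = 1%:M) ?mulmx1 ?UU// -dg1.
rewrite exprS IH -mulmxE !mulmxA -(mulmxA _ (U^t*) U) (mulmx1C UU) mulmx1.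
by rewrite -(mulmxA U) dgM; congr (_ *m _ *m _); apply: eq_dg => i; rewrite exprS.
Qed.

Lemma dg_sum (I : Type) (r : seq I) (a : I -> R) (f : I -> 'I_n -> R) :
  \sum_(k <- r) (a k)%:C *: dg (f k) = dg (fun i => \sum_(k <- r) a k * f k i).
Proof.
apply/matrixP => i j; rewrite summxE !mxE rmorph_sum/= -sumrMnl.
by apply: eq_bigr => k _; rewrite !mxE rmorphM/= mulrnAr.
Qed.

(** The partial sums keep the eigenvectors [U]; their eigenvalues are partial sums of the scalar
    exponential series. *)
Lemma expmx_spectral U x : U *m U^t* = 1%:M ->
  expmx (U *m dg x *m U^t*) = U *m dg (expR \o x) *m U^t*.
Proof.
move=> UU; apply: realify_limn.
have E (N : nat) :
    \sum_(k < N) ((k`!)%:R : C)^-1 *: (U *m dg x *m U^t*) ^+ k =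
    U *m dg (fun i => series (exp_coeff (x i)) N) *m U^t*.
  transitivity (U *m (\sum_(k < N) ((k`!%:R)^-1)%:C *: dg (fun i => x i ^+ k))
                  *m U^t*).
    rewrite mulmx_sumr mulmx_suml; apply: eq_bigr => k _.
    by rewrite spectralX// -scalemxAr -scalemxAl fmorphV rmorph_nat.
  rewrite dg_sum.
  suff -> : (fun i => \sum_(k < N) k`!%:R^-1 * x i ^+ k) =
            (fun i => series (exp_coeff (x i)) N) by [].
  apply/funext => i; rewrite /series/= big_mkord; apply: eq_bigr => k _.
  by rewrite /exp_coeff mulrC.
under eq_fun do rewrite E realify_spectral.
rewrite realify_spectral; apply: cvg_big => [|i _]; first exact: add_continuous.
by apply: cvgZr_tmp; exact: is_cvg_series_exp_coeff.
Qed.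

(** The chosen logarithm is some Hermitian [V y V^*] with [V e^y V^* = S]; applying [ln] to both
    diagonalisations of [S] identifies it. *)
Lemma lnmx_spectral U x : U *m U^t* = 1%:M -> (forall i, 0 < x i) ->
  lnmx (U *m dg x *m U^t*) = U *m dg (@ln R \o x) *m U^t*.
Proof.
move=> UU x0; set S := U *m dg x *m U^t*.
have [] : [set X | X \is hermsymmx /\ expmx X = S] (lnmx S).
  apply: (@xgetI _ 0 _ (U *m dg (@ln R \o x) *m U^t*)); split.
    by apply/hermP/herm_congr; exact: dg_adj.
  rewrite expmx_spectral//; congr (_ *m _ *m _); apply: eq_dg => i /=.
  by rewrite lnK// posrE.
move=> /herm_spectral [V [y [VV ->]]]; rewrite expmx_spectral// /S => e.
rewrite -(spectral_map (@ln R) VV UU e).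
by congr (_ *m _ *m _); apply: eq_dg => i /=; rewrite expRK.
Qed.
End SpectralFunctions.

(** * Differentiation of curves of complex matrices *)

Section ComplexCurves.
Variable R : realType.
Local Notation C := R[i].
Implicit Types (f g : R -> C) (t : R) (d e : C).

Lemma cReD d e : complex.Re (d + e) = complex.Re d + complex.Re e.
Proof. by case: d e => [? ?] [? ?]. Qed.

Lemma cImD d e : complex.Im (d + e) = complex.Im d + complex.Im e.
Proof. by case: d e => [? ?] [? ?]. Qed.

Lemma cReM d e : complex.Re (d * e) =
  complex.Re d * complex.Re e - complex.Im d * complex.Im e.
Proof. by case: d e => [? ?] [? ?]. Qed.

Lemma cImM d e : complex.Im (d * e) =
  complex.Re d * complex.Im e + complex.Im d * complex.Re e.
Proof. by case: d e => [? ?] [? ?]. Qed.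

Lemma is_derive_funM t (f g : R -> R) (d e : R) :
  is_derive t (1 : R) f d -> is_derive t (1 : R) g e ->
  is_derive t (1 : R) (fun s => f s * g s) (d * g t + f t * e).
Proof.
move=> fd ge.
have fge : is_derive t (1 : R) (fun s => f s * g s) (f t *: e + g t *: d).
  exact: is_deriveM fd ge.
by apply: is_derive_eq fge _; rewrite /GRing.scale /= addrC [g t * d]mulrC.
Qed.

Lemma is_derive_funD t (f g : R -> R) (d e : R) :
  is_derive t (1 : R) f d -> is_derive t (1 : R) g e ->
  is_derive t (1 : R) (fun s => f s + g s) (d + e).
Proof. exact: is_deriveD. Qed.

Lemma is_derive_funB t (f g : R -> R) (d e : R) :
  is_derive t (1 : R) f d -> is_derive t (1 : R) g e ->
  is_derive t (1 : R) (fun s => f s - g s) (d - e).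
Proof. exact: is_deriveB. Qed.

Definition is_cderive t f d :=
  is_derive t (1 : R) (fun s => complex.Re (f s)) (complex.Re d) /\
  is_derive t (1 : R) (fun s => complex.Im (f s)) (complex.Im d).

Lemma is_cderive_eq t f d e : is_cderive t f d -> d = e -> is_cderive t f e.
Proof. by move=> ? <-. Qed.

Lemma is_cderive_unique t f d e :
  is_cderive t f d -> is_cderive t f e -> d = e.
Proof.
move=> [[_ dr] [_ di]] [[_ er] [_ ei]].
by apply/eqP; rewrite eq_complex -dr -er -di -ei !eqxx.
Qed.

Lemma is_cderive_cst t d : is_cderive t (fun=> d) 0.
Proof. by split; exact: is_derive_cst. Qed.

Lemma is_cderive_real t (f : R -> R) (d : R) :
  is_derive t (1 : R) f d -> is_cderive t (fun s => (f s)%:C) d%:C.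
Proof. by move=> fd; split => //=; exact: is_derive_cst. Qed.

Lemma is_cderiveD t f g d e : is_cderive t f d -> is_cderive t g e ->
  is_cderive t (fun s => f s + g s) (d + e).
Proof.
move=> [fr fi] [gr gi]; split.
  by rewrite cReD; under eq_fun do rewrite cReD; exact: is_derive_funD.
by rewrite cImD; under eq_fun do rewrite cImD; exact: is_derive_funD.
Qed.

Lemma is_cderiveM t f g d e : is_cderive t f d -> is_cderive t g e ->
  is_cderive t (fun s => f s * g s) (d * g t + f t * e).
Proof.
move=> [fr fi] [gr gi]; split.
  under eq_fun do rewrite cReM.
  apply: is_derive_eq (is_derive_funB (is_derive_funM fr gr) (is_derive_funM fi gi)) _.
  by rewrite cReD !cReM; ring.
under eq_fun do rewrite cImM.
apply: is_derive_eq (is_derive_funD (is_derive_funM fr gi) (is_derive_funM fi gr)) _.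
by rewrite cImD !cImM; ring.
Qed.

Lemma is_cderive_sum (I : Type) (r : seq I) t (f : I -> R -> C) (d : I -> C) :
  (forall i, is_cderive t (f i) (d i)) ->
  is_cderive t (fun s => \sum_(i <- r) f i s) (\sum_(i <- r) d i).
Proof.
move=> fd; elim: r => [|i r IH].
  by rewrite big_nil; under eq_fun do rewrite big_nil; exact: is_cderive_cst.
by rewrite big_cons; under eq_fun do rewrite big_cons; exact: is_cderiveD.
Qed.

Lemma is_cderive_conj t f d : is_cderive t f d ->
  is_cderive t (fun s => Num.conj (f s)) (Num.conj d).
Proof.
have reJ (a : C) : complex.Re (Num.conj a) = complex.Re a by case: a.
have imJ (a : C) : complex.Im (Num.conj a) = - complex.Im a by case: a.
move=> [fr fi]; split.
  by rewrite reJ; under eq_fun do rewrite reJ.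
by rewrite imJ; under eq_fun do rewrite imJ; exact: is_deriveN.
Qed.

(** Existence is enough for determinants and adjugates: the derivative of an inverse is found
    afterwards from [c c^-1 = 1]. *)
Definition cderivable t f := exists d, is_cderive t f d.

Lemma cderivableM t f g : cderivable t f -> cderivable t g ->
  cderivable t (fun s => f s * g s).
Proof. by move=> [d fd] [e ge]; eexists; exact: is_cderiveM fd ge. Qed.

Lemma cderivable_cst t d : cderivable t (fun=> d).
Proof. by exists 0; exact: is_cderive_cst. Qed.

Lemma cderivable_sum (I : Type) (r : seq I) t (f : I -> R -> C) :
  (forall i, cderivable t (f i)) ->
  cderivable t (fun s => \sum_(i <- r) f i s).
Proof. by move=> /choice [d fd]; eexists; exact: (is_cderive_sum r fd). Qed.

Lemma cderivable_prod (I : Type) (r : seq I) t (f : I -> R -> C) :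
  (forall i, cderivable t (f i)) ->
  cderivable t (fun s => \prod_(i <- r) f i s).
Proof.
move=> fd; elim: r => [|i r IH].
  by under eq_fun do rewrite big_nil; exact: cderivable_cst.
by under eq_fun do rewrite big_cons; exact: cderivableM.
Qed.

Lemma cderivable_det m t (M : R -> 'M[C]_m) :
  (forall i j, cderivable t (fun s => M s i j)) ->
  cderivable t (fun s => \det (M s)).
Proof.
move=> Md; rewrite /determinant; apply: cderivable_sum => p.
by apply: cderivableM; [exact: cderivable_cst|exact: cderivable_prod].
Qed.

Lemma sqr_Re_Im_derivable t f : cderivable t f ->
  derivable (fun s => complex.Re (f s) ^+ 2 + complex.Im (f s) ^+ 2) t (1 : R).
Proof.
move=> [d [fr fi]].
have := is_derive_funD (is_derive_funM fr fr) (is_derive_funM fi fi).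
by under eq_fun do rewrite -!expr2; case.
Qed.

Lemma sqr_Re_Im_eq0 (z : C) :
  (complex.Re z ^+ 2 + complex.Im z ^+ 2 == 0) = (z == 0).
Proof. by rewrite paddr_eq0 ?sqr_ge0// !sqrf_eq0 eq_complex. Qed.

(** [|f|^2] is a continuous real function at [t] and has the same zeros as [f]. *)
Lemma cderivable_neq0 t f : cderivable t f -> f t != 0 ->
  \forall s \near t, f s != 0.
Proof.
move=> /sqr_Re_Im_derivable /derivable1_diffP /differentiable_continuous /= fc.
rewrite -sqr_Re_Im_eq0 => ft0.
near=> s; rewrite -sqr_Re_Im_eq0.
by near: s; exact: (cvgr_neq0 _ fc ft0).
Unshelve. all: by end_near. Qed.

Lemma cderivableV t f : cderivable t f -> f t != 0 ->
  cderivable t (fun s => (f s)^-1).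
Proof.
move=> fd ft0.
have [q qd] : exists q, is_derive t (1 : R)
    (fun s => (complex.Re (f s) ^+ 2 + complex.Im (f s) ^+ 2)^-1) q.
  eexists; apply: is_deriveV; first by rewrite sqr_Re_Im_eq0.
  exact: derivableP (sqr_Re_Im_derivable fd).
(* Writing [1 / f] as [conj f / |f|^2] leaves only a real function to invert. *)
have -> : (fun s => (f s)^-1) = (fun s => Num.conj (f s) *
    ((complex.Re (f s) ^+ 2 + complex.Im (f s) ^+ 2)^-1)%:C).
  apply/funext => s; apply/eqP; rewrite eq_complex cReM cImM.
  by case: (f s) => a b /=; rewrite !mulr0 subr0 add0r mulNr !eqxx.
apply: cderivableM.
  by case: fd => d fd; exists (Num.conj d); exact: is_cderive_conj.
exists q%:C; exact: is_cderive_real qd.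
Qed.
End ComplexCurves.

(** * Calculus of matrix-valued curves *)

Section MatrixCurves.
Variables (R : realType) (n : nat).
Local Notation C := R[i].
Implicit Types (c e : R -> 'M[C]_n) (t : R) (V W X Z : 'M[C]_n).

Lemma curve_deriveP c t V : curve_derive c t V <->
  forall i j, is_cderive t (fun s => c s i j) (V i j).
Proof.
have reE X i j : realify X i (lshift n j) = complex.Re (X i j).
  by rewrite realifyE (unsplitK (inl j)).
have imE X i j : realify X i (rshift n j) = complex.Im (X i j).
  by rewrite realifyE (unsplitK (inr j)).
split=> [[/[dup] /derivable_mxP cd /derive_mx ->] /matrixP VE i j|cd].
  split; apply: DeriveDef.
  - have := cd i (lshift n j); by under eq_fun do rewrite reE.
  - by have := VE i (lshift n j); rewrite mxE reE; under eq_fun do rewrite reE.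
  - have := cd i (rshift n j); by under eq_fun do rewrite imE.
  - by have := VE i (rshift n j); rewrite mxE imE; under eq_fun do rewrite imE.
have entry i j :
    is_derive t (1 : R) (fun s => realify (c s) i j) (realify V i j).
  rewrite realifyE; under eq_fun do rewrite realifyE.
  by case: fintype.split => k; case: (cd i k).
have crd : derivable (fun s => realify (c s)) t (1 : R).
  by apply/derivable_mxP => i j; case: (entry i j).
apply: DeriveDef => //; rewrite derive_mx//; apply/matrixP => i j.
by rewrite mxE; case: (entry i j).
Qed.

Lemma curve_derive_eq c t V W : curve_derive c t V -> V = W ->
  curve_derive c t W.
Proof. by move=> ? <-. Qed.

Lemma curve_derive_unique c t V W :
  curve_derive c t V -> curve_derive c t W -> V = W.
Proof.
move=> /curve_deriveP cV /curve_deriveP cW; apply/matrixP => i j.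
exact: is_cderive_unique (cV i j) (cW i j).
Qed.

Lemma curve_derive_near c e t V : (\forall s \near t, c s = e s) ->
  curve_derive c t V -> curve_derive e t V.
Proof.
move=> ce; apply: near_eq_is_derive; near=> s.
by congr realify; near: s.
Unshelve. all: by end_near. Qed.

Lemma curve_derive_cst t X : curve_derive (fun=> X) t 0.
Proof. by apply/curve_deriveP => i j; rewrite mxE; exact: is_cderive_cst. Qed.

Lemma curve_deriveM c e t V W : curve_derive c t V -> curve_derive e t W ->
  curve_derive (fun s => c s *m e s) t (V *m e t + c t *m W).
Proof.
move=> /curve_deriveP cV /curve_deriveP eW; apply/curve_deriveP => i j.
under eq_fun do rewrite mxE; rewrite !mxE -big_split /=.
by apply: is_cderive_sum => k; exact: is_cderiveM.
Qed.

Lemma curve_derive_line t X Z :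
  curve_derive (fun s => X + s%:C *: Z) t Z.
Proof.
apply/curve_deriveP => i j; under eq_fun do rewrite !mxE.
apply: is_cderive_eq.
  apply: is_cderiveD; first exact: is_cderive_cst.
  apply: is_cderiveM; last exact: is_cderive_cst.
  exact: is_cderive_real (is_derive_id _ _).
by rewrite add0r mulr0 addr0 mul1r.
Qed.

Lemma curve_derive_dg (f : R -> 'I_n -> R) t (d : 'I_n -> R) :
  (forall i, is_derive t (1 : R) (f ^~ i) (d i)) ->
  curve_derive (fun s => dg (f s)) t (dg d).
Proof.
move=> fd; apply/curve_deriveP => i j; under eq_fun do rewrite !mxE.
rewrite !mxE; case: eqP => [->|_].
  by rewrite mulr1n; under eq_fun do rewrite mulr1n; exact: is_cderive_real.
by rewrite mulr0n; under eq_fun do rewrite mulr0n; exact: is_cderive_cst.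
Qed.

Lemma curve_derive_adj c t V : curve_derive c t V ->
  curve_derive (fun s => (c s)^t*) t (V^t*).
Proof.
move=> /curve_deriveP cV; apply/curve_deriveP => i j; rewrite !mxE.
by under eq_fun do rewrite !mxE; exact: is_cderive_conj.
Qed.

Lemma curve_derive_Retr c t V : curve_derive c t V ->
  is_derive t (1 : R) (fun s => complex.Re (\tr (c s))) (complex.Re (\tr V)).
Proof.
move=> /curve_deriveP cV.
by have [] := is_cderive_sum (index_enum 'I_n) (fun i => cV i i).
Qed.

(** Cramer's formula gives differentiability; differentiating [c c^-1 = 1] then gives the value. *)
Lemma curve_derive_inv c t V : curve_derive c t V -> c t \in unitmx ->
  curve_derive (fun s => invmx (c s)) t (- (invmx (c t) *m V *m invmx (c t))).
Proof.
move=> cV cu; have /curve_deriveP cVE := cV.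
have cd i j : cderivable t (fun s => c s i j) by exists (V i j).
have dd := cderivable_det cd.
have dt0 : \det (c t) != 0 by rewrite -unitfE -unitmxE.
have near_unit : \forall s \near t, c s \in unitmx.
  by near do rewrite unitmxE unitfE; exact: cderivable_neq0.
(* [invmx] is given by this formula on invertible matrices, hence near [t]. *)
pose g s := (\det (c s))^-1 *: \adj (c s).
have gE : \forall s \near t, g s = invmx (c s).
  near=> s; have su : c s \in unitmx by near: s.
  by rewrite /g /invmx su.
have [W gW] : exists W, curve_derive g t W.
  have gd i j : cderivable t (fun s => g s i j).
    rewrite /g; under eq_fun do rewrite !mxE.
    apply: cderivableM; first exact: cderivableV.
    apply: cderivableM; first exact: cderivable_cst.
    apply: cderivable_det => k l.
    by under eq_fun do rewrite !mxE; exact: cd.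
  exists (\matrix_(i, j) sval (cid (gd i j))); apply/curve_deriveP => i j.
  by rewrite mxE; exact: svalP.
have {gW}iW := curve_derive_near gE gW.
have cE : \forall s \near t, 1%:M = c s *m invmx (c s).
  near=> s; have su : c s \in unitmx by near: s.
  by rewrite (mulmxV su).
have := curve_derive_unique (curve_deriveM cV iW)
  (curve_derive_near cE (curve_derive_cst t _)).
move/eqP; rewrite addr_eq0 => /eqP /(congr1 (fun X => - (invmx (c t) *m X))).
rewrite mulmxN opprK mulKmx// mulmxA => E.
by apply: curve_derive_eq iW _; rewrite -E.
Unshelve. all: by end_near. Qed.
End MatrixCurves.

(** * The gradient of the squared distance *)

Section RealEstimates.
Variable R : realType.
Implicit Types (x y b s : R).

(** The difference quotient at [h] is within [K |h|] of [D]. *)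
Lemma quadratic_is_derive (f : R -> R) (D K d : R) : 0 < d -> 0 <= K ->
  (forall s, `|s| < d -> `|f s - f 0 - s * D| <= K * s ^+ 2) ->
  is_derive (0 : R) (1 : R) f D.
Proof.
move=> d0 K0 fK.
have lim : h^-1 *: ((f \o shift 0) (h *: (1 : R)) - f 0) @[h --> 0^'] --> D.
  apply/cvgrPdist_le => e e0; near=> h.
  have h0 : h != 0 by near: h; exact: nbhs_dnbhs_neq.
  have hd : `|h| < d by near: h; exact: dnbhs0_lt.
  have he : `|h| <= e / (K + 1).
    by near: h; apply: dnbhs0_le; rewrite divr_gt0// ltr_pwDr.
  have E : D - h^-1 * (f h - f 0) = - h^-1 * (f h - f 0 - h * D).
    by field.
  rewrite /= /GRing.scale /= mulr1 addr0 E normrM normrN normfV.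
  rewrite ler_pdivrMl ?normr_gt0// (le_trans (fK _ hd))// -real_normK ?num_real//.
  rewrite expr2 mulrA mulrC ler_pM2l ?normr_gt0//.
  move: he; rewrite ler_pdivlMr ?ltr_pwDr// mulrDr mulr1 => he.
  by rewrite mulrC (le_trans _ he)// lerDl.
apply: DeriveDef; first by apply/cvg_ex; exists D.
exact: cvg_lim lim.
Unshelve. all: by end_near. Qed.

Lemma ln_div_le x y : 0 < x -> 0 < y -> ln y - ln x <= (y - x) / x.
Proof.
move=> x0 y0; rewrite -ln_div ?posrE//.
have -> : (y - x) / x = y / x - 1 by field; rewrite gt_eqF.
rewrite -[y / x in leLHS](subrKC 1); apply: le_ln1Dx.
by rewrite ltrBrDl subrr divr_gt0.
Qed.

(** Concavity of [ln] gives [p <= l <= u]. The remainder is [2 ln x (l - u) + l^2], where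
    [u - l <= u - p = (y - x)^2 / (x y)] and [l^2 <= u^2 + p^2]; then [y >= b] is used. *)
Lemma ln_sqr_taylor x y b : 0 < x -> 0 < b -> b <= y ->
  `|ln y ^+ 2 - ln x ^+ 2 - 2 * ln x / x * (y - x)| <=
  (2 * `|ln x| / (x * b) + (x ^-2 + b ^-2)) * (y - x) ^+ 2.
Proof.
move=> x0 b0 ley; have y0 := lt_le_trans b0 ley.
set l := ln y - ln x; set u := (y - x) / x; set p := (y - x) / y.
have lu : l <= u by exact: ln_div_le.
have pl : p <= l.
  have := ln_div_le y0 x0; rewrite -/l /p -(opprB y x) mulNr -[ln x - ln y]opprB.
  by rewrite lerN2.
have -> : ln y ^+ 2 - ln x ^+ 2 - 2 * ln x / x * (y - x) =
          2 * ln x * (l - u) + l ^+ 2.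
  by rewrite /l /u; field; rewrite gt_eqF.
apply: le_trans (ler_normD _ _) _; rewrite [leRHS]mulrDl; apply: lerD.
  rewrite !normrM (@ger0_norm _ 2)// distrC (@ger0_norm _ (u - l)) ?subr_ge0//.
  rewrite -!mulrA ler_pM2l// ler_wpM2l//.
  have up : u - p = (y - x) ^+ 2 / (x * y).
    by rewrite /u /p; field; rewrite !gt_eqF.
  apply: (@le_trans _ _ (u - p)); first by rewrite lerD2l lerN2.
  rewrite up mulrC ler_wpM2r ?sqr_ge0// lef_pV2 ?posrE ?mulr_gt0//.
  by rewrite ler_pM2l.
rewrite ger0_norm ?sqr_ge0//.
have l2 : l ^+ 2 <= u ^+ 2 + p ^+ 2.
  have [l0|l0] := leP 0 l.
    rewrite (@le_trans _ _ (u ^+ 2)) ?lerDl ?sqr_ge0//.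
    by rewrite lerXn2r// nnegrE// (le_trans l0).
  rewrite (@le_trans _ _ (p ^+ 2)) ?lerDr ?sqr_ge0//.
  rewrite -(sqrrN l) -(sqrrN p) lerXn2r ?nnegrE ?lerN2 ?oppr_ge0 ?(ltW l0)//.
  by rewrite (le_trans pl)// ltW.
apply: (le_trans l2); rewrite [leRHS]mulrDl; apply: lerD.
  by rewrite /u expr_div_n mulrC.
rewrite /p expr_div_n mulrC ler_wpM2r ?sqr_ge0//.
by rewrite lef_pV2 ?posrE ?exprn_gt0// lerXn2r// nnegrE ltW.
Qed.

(* Klein-type estimate: the unistochastic weights [P i j = |W i j|^2] link the
   spectra [x] and [y] of two Hermitian matrices with eigenbases related by
   [W], so that a scalar Taylor estimate for [ln ^ 2] becomes one for traces. *)
Lemma stochastic_taylor (n : nat) (P : 'I_n -> 'I_n -> R) (x y z : 'I_n -> R)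
    (s b q : R) :
  (forall i j, 0 <= P i j) ->
  (forall i, \sum_j P i j = 1) -> (forall j, \sum_i P i j = 1) ->
  (forall i, \sum_j P i j * y j = x i + s * z i) ->
  \sum_j y j ^+ 2 = \sum_i x i ^+ 2 + 2 * s * (\sum_i x i * z i) + s ^+ 2 * q ->
  0 < b -> (forall i, 2 * b <= x i) -> s ^+ 2 * q < b ^+ 2 ->
  (forall j, b <= y j) /\
  `|\sum_j ln (y j) ^+ 2 - \sum_i ln (x i) ^+ 2 -
    s * \sum_i 2 * ln (x i) / x i * z i| <=
  (\sum_i (2 * `|ln (x i)| / (x i * b) + ((x i) ^-2 + b ^-2))) * q * s ^+ 2.
Proof.
move=> P0 Pr Pc Py yy b0 bx sq.
have x0 i : 0 < x i by rewrite (lt_le_trans _ (bx i))// mulr_gt0.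
have colsum (f : 'I_n -> R) : \sum_i \sum_j P i j * f j = \sum_j f j.
  by rewrite exchange_big /=; apply: eq_bigr => j _; rewrite -mulr_suml Pc mul1r.
have rowsum (f : 'I_n -> R) : \sum_i \sum_j P i j * f i = \sum_i f i.
  by apply: eq_bigr => i _; rewrite -mulr_suml Pr mul1r.
(* Expanding the square, the row means and the second moment of [y] make all terms of order below
   [s^2] cancel. *)
have var : \sum_i \sum_j P i j * (y j - x i) ^+ 2 = s ^+ 2 * q.
  transitivity (\sum_i \sum_j P i j * y j ^+ 2 + \sum_i \sum_j P i j * x i ^+ 2
                - 2 * \sum_i x i * \sum_j P i j * y j).
    rewrite mulr_sumr -sumrN -!big_split /=; apply: eq_bigr => i _.
    rewrite !mulr_sumr -sumrN -!big_split /=; apply: eq_bigr => j _; ring.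
  rewrite colsum (rowsum (fun i => x i ^+ 2)) yy.
  under [X in _ - 2 * X]eq_bigr do rewrite Py mulrDr -expr2 mulrCA.
  by rewrite big_split /= -mulr_sumr; ring.
(* If [y j < b], then [x i - y j >= b] for all [i], so column [j] alone contributes at least [b^2]
   to [var], against [s^2 q < b^2]. *)
have yb j : b <= y j.
  rewrite leNgt; apply/negP => yjb; move: sq; rewrite ltNge => /negP; apply.
  rewrite -var exchange_big /= (bigD1 j)//= ler_wpDr//.
    by apply: sumr_ge0 => k _; apply: sumr_ge0 => i _; rewrite mulr_ge0 ?sqr_ge0.
  rewrite -[leLHS]mul1r -(Pc j) mulr_suml; apply: ler_sum => i _.
  rewrite ler_wpM2l// -(sqrrN (y j - x i)) opprB; have := bx i => bxi.
  by apply: lerXn2r; rewrite ?nnegrE; lra.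
split=> //.
pose K i := 2 * `|ln (x i)| / (x i * b) + ((x i) ^-2 + b ^-2).
rewrite -[\sum_i (_ + _)]/(\sum_i K i).
have -> : \sum_j ln (y j) ^+ 2 - \sum_i ln (x i) ^+ 2 -
    s * \sum_i 2 * ln (x i) / x i * z i =
    \sum_i \sum_j P i j * (ln (y j) ^+ 2 - ln (x i) ^+ 2 -
                           2 * ln (x i) / x i * (y j - x i)).
  rewrite -(colsum (fun j => ln (y j) ^+ 2)) -(rowsum (fun i => ln (x i) ^+ 2)).
  (* By [Py] and [Pr], the mean of [y j - x i] over row [i] is [s * z i]. *)
  have -> : s * (\sum_i 2 * ln (x i) / x i * z i) =
      \sum_i \sum_j P i j * (2 * ln (x i) / x i * (y j - x i)).
    rewrite mulr_sumr; apply: eq_bigr => i _.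
    transitivity (2 * ln (x i) / x i *
        (\sum_j P i j * y j - (\sum_j P i j) * x i)).
      by rewrite Py Pr; ring.
    rewrite mulr_suml -sumrB mulr_sumr; apply: eq_bigr => j _; ring.
  rewrite -!sumrB; apply: eq_bigr => i _; rewrite -!sumrB.
  by apply: eq_bigr => j _; rewrite -!mulrBr.
apply: (@le_trans _ _ (\sum_i \sum_j P i j * (K i * (y j - x i) ^+ 2))).
  apply: le_trans (ler_norm_sum _ _ _) _; apply: ler_sum => i _.
  apply: le_trans (ler_norm_sum _ _ _) _; apply: ler_sum => j _.
  rewrite normrM ger0_norm// ler_wpM2l//.
  exact: ln_sqr_taylor.
have K0 i : 0 <= K i.
  by rewrite /K !addr_ge0 ?invr_ge0 ?exprn_ge0 ?divr_ge0 ?mulr_ge0// ltW.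
have -> : (\sum_i K i) * q * s ^+ 2 = (\sum_k K k) * (s ^+ 2 * q) by ring.
rewrite -var mulr_sumr; apply: ler_sum => i _.
rewrite mulr_sumr; apply: ler_sum => j _.
rewrite mulrCA ler_wpM2r ?(mulr_ge0 (P0 i j) (sqr_ge0 _))//.
by rewrite (bigD1 i)//= lerDl sumr_ge0.
Qed.
End RealEstimates.

(** * Reduction to diagonal form and computation of the gradient *)

Section Gradient.
Variables (R : realType) (n : nat).
Local Notation C := R[i].
Implicit Types (X Y Z S B U V W N H : 'M[C]_n) (x y : 'I_n -> R).

(** With [G = B^(1/2)], diagonalise [G^-1 S G^-1] as [U x U^*] and take [N = G U]. *)
Lemma simultaneous_congr S B : posdefmx S -> posdefmx B -> exists N x,
  [/\ N \in unitmx, forall i, 0 < x i, S = N *m dg x *m N^t* & B = N *m N^t*].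
Proof.
move=> pS pB; have [pG GG] := sqrtmxP pB; set G := sqrtmx B in pG GG.
have Gu := posdef_unit pG; have Gh := posdef_herm pG.
have [V [b [VV b0 SE]]] := posdef_spectral pS.
have : posdefmx (invmx G *m V *m dg b *m (invmx G *m V)^t*).
  by apply: posdef_congr => //; rewrite unitmx_mul unitmx_inv Gu unitary_unit.
rewrite -(congr_comp (invmx G) V (dg b)) -SE => /posdef_spectral [U [x [UU x0 UE]]].
exists (G *m U), x; split => //.
- by rewrite unitmx_mul Gu unitary_unit.
- by rewrite -(congr_comp G U (dg x)) -UE (congr_cancel S Gu).
- by rewrite (congr_unitary G UU) Gh.
Qed.

(** [polar_unitary] diagonalises [S^(-1/2) B S^(-1/2)] with eigenvalues [1 / x i], whence the sign;
    the middle identity relates its eigenbasis to [N]. *)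
Lemma ln_ratio N x : N \in unitmx -> (forall i, 0 < x i) ->
  let S := N *m dg x *m N^t* in
  exists U, [/\ U *m U^t* = 1%:M,
    sqrtmx S *m U = N *m dg (fun i => Num.sqrt (x i)) &
    lnmx (invsqrtmx S *m (N *m N^t*) *m invsqrtmx S) =
      U *m dg (fun i => - ln (x i)) *m U^t*].
Proof.
move=> Nu x0 S; have pS : posdefmx S by exact: posdef_congr.
have [] := sqrtmxP pS; rewrite /invsqrtmx.
move: (sqrtmx S) => H pH HH.
have rr i : Num.sqrt (x i) * Num.sqrt (x i) = x i.
  by rewrite -expr2 sqr_sqrtr// ltW.
have r0 i : Num.sqrt (x i) != 0 by rewrite gt_eqF// sqrtr_gt0.
have QQ : dg x = dg (fun i => Num.sqrt (x i)) *m dg (fun i => Num.sqrt (x i)).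
  by rewrite dgM; apply: eq_dg => i; rewrite rr.
rewrite /S QQ in HH.
have [U [UU HU ->]] := polar_unitary Nu (posdef_unit pH) (posdef_herm pH)
  (dg_adj _) (dg_adj _) (dgVr r0) HH.
exists U; split => //; rewrite dgM lnmx_spectral//; last first.
  by move=> i; rewrite -invfM rr invr_gt0.
congr (_ *m _ *m _); apply: eq_dg => i /=.
by rewrite -invfM rr lnV// posrE.
Qed.

Lemma output_cost_congr N x : N \in unitmx -> (forall i, 0 < x i) ->
  output_cost (N *m N^t*) (N *m dg x *m N^t*) = \sum_i ln (x i) ^+ 2.
Proof.
move=> Nu x0; rewrite /output_cost /pd_dist.
have [U [UU _ ->]] := ln_ratio Nu x0.
by rewrite frobenius_spectral//; apply: eq_bigr => i _; rewrite sqrrN.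
Qed.

Lemma pd_metric_congr N x (v : 'I_n -> R) X : N \in unitmx ->
  (forall i, x i != 0) ->
  pd_metric (N *m dg x *m N^t*) (N *m dg v *m N^t*) X =
  complex.Re (\tr (dg (fun i => v i / x i ^+ 2) *m
                    (invmx N *m X *m (invmx N)^t*))).
Proof.
move=> Nu x0; rewrite /pd_metric (tr_congr _ _ Nu (dgVr x0)) !dgM.
by congr (complex.Re (\tr (_ *m _))); apply: eq_dg => i; field.
Qed.

Lemma Retr_normE X : complex.Re (\tr (X *m X^t*)) =
  \sum_i \sum_j (complex.Re (X i j) ^+ 2 + complex.Im (X i j) ^+ 2).
Proof.
rewrite /mxtrace raddf_sum; apply: eq_bigr => i _.
rewrite mxE raddf_sum; apply: eq_bigr => j _.
by rewrite [X^t* _ _]mxE [X^T _ _]mxE conjCE; case: (X i j) => a b /=; ring.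
Qed.

Lemma Retr_ge0 X : 0 <= complex.Re (\tr (X *m X^t*)).
Proof.
rewrite Retr_normE; apply: sumr_ge0 => i _; apply: sumr_ge0 => j _.
by rewrite addr_ge0 ?sqr_ge0.
Qed.

Lemma Retr_eq0 X : complex.Re (\tr (X *m X^t*)) = 0 -> X = 0.
Proof.
have pos i j : 0 <= complex.Re (X i j) ^+ 2 + complex.Im (X i j) ^+ 2.
  by rewrite addr_ge0 ?sqr_ge0.
rewrite Retr_normE => /eqP; rewrite psumr_eq0; last first.
  by move=> i _; apply: sumr_ge0.
move=> /allP X0; apply/matrixP => i j; rewrite mxE.
have := X0 i (mem_index_enum _); rewrite /= psumr_eq0//.
move=> /allP /(_ j (mem_index_enum _)); rewrite /= sqr_Re_Im_eq0.
by move=> /eqP.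
Qed.

(** Testing with [Z = X] gives the squared Frobenius norm of [X]. *)
Lemma Retr_nondegenerate X : X \is hermsymmx ->
  (forall Z, Z \is hermsymmx -> complex.Re (\tr (X *m Z)) = 0) -> X = 0.
Proof.
by move=> Xh /(_ _ Xh) tr0; apply: Retr_eq0; move/hermP : Xh => ->.
Qed.

(** Source of the weights [|W_ij|^2]: [y = 1] for [W] and [W^*] gives unit row and column sums, and
    the perturbed spectrum gives the row means. *)
Lemma congr_diag W y i : (W *m dg y *m W^t*) i i =
  (\sum_j (complex.Re (W i j) ^+ 2 + complex.Im (W i j) ^+ 2) * y j)%:C.
Proof.
rewrite mxE rmorph_sum; apply: eq_bigr => j _.
rewrite mul_dg [W^t* _ _]mxE [W^T _ _]mxE conjCE /=.
by case: (W i j) => a b /=; apply/eqP; rewrite eq_complex /=;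
  apply/andP; split; apply/eqP; ring.
Qed.

Lemma dg_line_herm x (s : R) Z : Z \is hermsymmx ->
  dg x + s%:C *: Z \is hermsymmx.
Proof.
move=> /hermP Zh; apply/hermP/herm_line => //; last exact: dg_adj.
exact: conjc_real.
Qed.

Lemma cReMr (a : R) (z : C) : complex.Re (a%:C * z) = a * complex.Re z.
Proof. by rewrite cReM /= mul0r subr0. Qed.

Lemma perturbed_spectrum x y (s : R) Z W (b : R) :
  Z \is hermsymmx -> W *m W^t* = 1%:M ->
  dg x + s%:C *: Z = W *m dg y *m W^t* ->
  0 < b -> (forall i, 2 * b <= x i) ->
  s ^+ 2 * complex.Re (\tr (Z *m Z)) < b ^+ 2 ->
  (forall j, b <= y j) /\
  `|\sum_j ln (y j) ^+ 2 - \sum_i ln (x i) ^+ 2 -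
    s * \sum_i 2 * ln (x i) / x i * complex.Re (Z i i)| <=
  (\sum_i (2 * `|ln (x i)| / (x i * b) + ((x i) ^-2 + b ^-2))) *
   complex.Re (\tr (Z *m Z)) * s ^+ 2.
Proof.
move=> Zh WW E b0 bx sq; have W'W := mulmx1C WW.
apply: (stochastic_taylor (P := fun i j =>
  complex.Re (W i j) ^+ 2 + complex.Im (W i j) ^+ 2)) => //.
- by move=> i j; rewrite addr_ge0 ?sqr_ge0.
- move=> i; have := congr_diag W (fun=> 1) i.
  rewrite dg1 mulmx1 WW mxE eqxx => /(congr1 (@complex.Re R)) /= ->.
  by apply: eq_bigr => j _; rewrite mulr1.
- move=> j; have := congr_diag (W^t*) (fun=> 1) j.
  rewrite dg1 mulmx1 trmxCK W'W mxE eqxx => /(congr1 (@complex.Re R)) /= ->.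
  apply: eq_bigr => i _; rewrite !mxE conjCE mulr1.
  by case: (W i j) => a c /=; rewrite sqrrN.
- move=> i; have := congr_diag W y i.
  rewrite -E !mxE eqxx mulr1n => /(congr1 (@complex.Re R)).
  by rewrite cReD cReMr /= => ->.
(* The trace of the square, computed in both bases, is the second-moment hypothesis with
   [q = tr Z^2]. *)
have : \tr ((dg x + s%:C *: Z) *m (dg x + s%:C *: Z)) =
       \tr (dg (fun j => y j * y j)).
  rewrite E !mulmxA -(mulmxA _ (W^t*) W) W'W mulmx1 -(mulmxA W) dgM.
  by rewrite mxtrace_mulC mulmxA W'W mul1mx.
move/(congr1 (@complex.Re R)).
have trdg (f : 'I_n -> R) : complex.Re (\tr (dg f)) = \sum_j f j.
  by rewrite mxtrace_diag raddf_sum; apply: eq_bigr => j _; rewrite mxE.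
have trdgM : complex.Re (\tr (dg x *m Z)) = \sum_i x i * complex.Re (Z i i).
  by rewrite /mxtrace raddf_sum; apply: eq_bigr => i _; rewrite /= dg_mul cReMr.
rewrite trdg mulmxDl !mulmxDr -!scalemxAl -!scalemxAr !mxtraceD !mxtraceZ.
rewrite (mxtrace_mulC Z) !cReD !cReMr trdgM dgM trdg => yy.
transitivity (\sum_j y j * y j); first by apply: eq_bigr => j _; rewrite expr2.
rewrite -yy; transitivity (\sum_i x i * x i +
  (s * (\sum_i x i * complex.Re (Z i i)) +
  (s * (\sum_i x i * complex.Re (Z i i)) +
   s * (s * complex.Re (\tr (Z *m Z)))))); first by rewrite !addrA.
under [\sum_i x i ^+ 2]eq_bigr do rewrite expr2.
ring.
Qed.

(** The differential has coefficients [2 ln x_i / x_i] on [Z_ii], and the metric at [dg x] divides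
    by [x_i^2]; hence the entries [2 x_i ln x_i]. *)
Lemma pd_gradient_congr N x : N \in unitmx -> (forall i, 0 < x i) ->
  is_pd_gradient (output_cost (N *m N^t*)) (N *m dg x *m N^t*)
    (N *m dg (fun i => 2 * (x i * ln (x i))) *m N^t*).
Proof.
move=> Nu x0; split; first by apply/hermP/herm_congr; exact: dg_adj.
move=> X Xh; pose Z := invmx N *m X *m (invmx N)^t*.
have Zh : Z \is hermsymmx by apply/hermP/herm_congr/hermP.
have x0' i : x i != 0 by rewrite gt_eqF.
have lineE (s : R) : N *m dg x *m N^t* + s%:C *: X =
    N *m (dg x + s%:C *: Z) *m N^t* by exact: congr_line.
have -> : pd_metric (N *m dg x *m N^t*)
    (N *m dg (fun i => 2 * (x i * ln (x i))) *m N^t*) X =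
    \sum_i 2 * ln (x i) / x i * complex.Re (Z i i).
  rewrite pd_metric_congr// -/Z /mxtrace raddf_sum; apply: eq_bigr => i _.
  by rewrite /= dg_mul cReMr; congr (_ * _); field.
set q := complex.Re (\tr (Z *m Z)).
have q0 : 0 <= q by have := Retr_ge0 Z; move/hermP : Zh => ->.
(* [c] bounds every [1 / x i], so [2 b = 1 / c] bounds every [x i] from below; the [1] keeps [c]
   positive when [n = 0]. *)
pose c := 1 + \sum_i (x i)^-1.
have sum0 : 0 <= \sum_i (x i)^-1.
  by apply: sumr_ge0 => i _; rewrite invr_ge0 ltW.
have c0 : 0 < c by rewrite /c ltr_pwDl.
pose b := (2 * c)^-1.
have b0 : 0 < b by rewrite /b invr_gt0 mulr_gt0.
have bx i : 2 * b <= x i.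
  rewrite /b invfM mulrA divff// mul1r -[x i]invrK lef_pV2 ?posrE ?invr_gt0//.
  rewrite /c (bigD1 i)//= addrCA lerDl addr_ge0// sumr_ge0// => j _.
  by rewrite invr_ge0 ltW.
(* This radius gives [|s| (q + 1) < b], hence [s^2 q < b^2], also when [q = 0]. *)
apply: (quadratic_is_derive (d := b / (q + 1))
  (K := (\sum_i (2 * `|ln (x i)| / (x i * b) + ((x i) ^-2 + b ^-2))) * q)).
- by rewrite divr_gt0// ltr_pwDr.
- rewrite mulr_ge0// sumr_ge0// => i _.
  by rewrite !addr_ge0 ?invr_ge0 ?exprn_ge0 ?divr_ge0 ?mulr_ge0// ltW.
move=> s sd.
have [W [y [WW WE]]] := herm_spectral (dg_line_herm x s Zh).
have sq : s ^+ 2 * q < b ^+ 2.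
  move: sd; rewrite ltr_pdivlMr ?ltr_pwDr// => sd.
  have {}sd : (`|s| * (q + 1)) ^+ 2 < b ^+ 2.
    have p0 : 0 <= `|s| * (q + 1) by rewrite mulr_ge0// addr_ge0.
    by rewrite !expr2 ltr_pM.
  apply: le_lt_trans sd; rewrite exprMn real_normK ?num_real//.
  rewrite ler_wpM2l ?sqr_ge0//; nra.
have [yb est] := perturbed_spectrum Zh WW WE b0 bx sq.
rewrite lineE WE lineE scale0r addr0 (output_cost_congr Nu x0).
(* [W] is absorbed into [N]: [N W] still yields [B], and carries [y] to the perturbed point. *)
rewrite congr_comp -(congr_unitary N WW).
rewrite output_cost_congr//; last by move=> j; exact: lt_le_trans (yb j).
by rewrite unitmx_mul Nu unitary_unit.
Qed.

(** Both gradients pair equally with every Hermitian [Z], so [S^-1 (V - W) S^-1] vanishes by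
    nondegeneracy. *)
Lemma pd_gradient_unique (F : 'M[C]_n -> R) S V W : posdefmx S ->
  is_pd_gradient F S V -> is_pd_gradient F S W -> V = W.
Proof.
move=> pS [/hermP Vh gV] [/hermP Wh gW].
have Su := posdef_unit pS; have Sh := posdef_herm pS.
apply/eqP; rewrite -subr_eq0; apply/eqP/(sandwich_eq0 Su).
apply: Retr_nondegenerate.
  by apply/hermP/herm_sandwich; [exact: herm_inv|exact: herm_sub].
move=> Z Zh; have [_ dV] := gV Z Zh; have [_ dW] := gW Z Zh.
have e : pd_metric S V Z = pd_metric S W Z by rewrite -dV -dW.
rewrite mulmxBr !mulmxBl linearB /= raddfB.
by apply/eqP; rewrite subr_eq0; apply/eqP.
Qed.
End Gradient.

(** * Geodesics *)

Section Geodesics.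
Variables (R : realType) (n : nat).
Local Notation C := R[i].
Implicit Types (c e : R -> 'M[C]_n) (t : R) (S B T U V W Z N : 'M[C]_n).

Lemma curve_derive_const c : (forall t, curve_derive c t 0) ->
  forall s t, c s = c t.
Proof.
move=> c0 s t; apply/matrixP => i j; apply/eqP; rewrite eq_complex.
have cij r : is_cderive r (fun u => c u i j) 0.
  by have /curve_deriveP /(_ i j) := c0 r; rewrite mxE.
by apply/andP; split; apply/eqP;
  apply: (@is_derive_0_is_cst _ (fun u => _ (c u i j))) => r; case: (cij r).
Qed.

Lemma derive1_val (f : R -> R) t (d : R) : is_derive t (1 : R) f d ->
  derive1 f t = d.
Proof. by rewrite derive1E => -[]. Qed.

Lemma pd_metric_derive c1 c t W Z :
  c t \in unitmx -> curve_derive c t (c1 t) -> curve_derive c1 t W ->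
  derive1 (fun s => pd_metric (c s) (c1 s) Z) t =
  complex.Re (linear_form (invmx (c t)) W Z) -
  2 * complex.Re (quadratic_form (invmx (c t)) (c1 t) Z).
Proof.
move=> cu dc dc1; have dci := curve_derive_inv dc cu.
have := curve_deriveM (curve_deriveM (curve_deriveM dci dc1) dci)
  (curve_derive_cst t Z).
move/curve_derive_Retr/derive1_val; rewrite /pd_metric => ->.
rewrite metric_variation mulr2n.
have ReBD (a b : C) : complex.Re (a - (b + b)) =
    complex.Re a - 2 * complex.Re b by case: a b => [? ?] [? ?] /=; ring.
exact: ReBD.
Qed.

Lemma pd_metric_line_derive S V Z : S \in unitmx ->
  derive1 (fun s : R => pd_metric (S + s%:C *: Z) V V) 0 =
  - 2 * complex.Re (quadratic_form (invmx S) V Z).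
Proof.
move=> Su; have S0 : S + (0 : R)%:C *: Z = S by rewrite scale0r addr0.
have dl := curve_derive_line 0 S Z.
have := curve_derive_inv dl; rewrite S0 => /(_ Su) dli.
have dV := curve_derive_cst (0 : R) V.
have := curve_deriveM (curve_deriveM (curve_deriveM dli dV) dli) dV.
move/curve_derive_Retr/derive1_val; rewrite /pd_metric => ->.
rewrite S0 metric_line_variation mulr2n.
have ReND (a : C) : complex.Re (- (a + a)) = - 2 * complex.Re a.
  by case: a => [? ?] /=; ring.
by rewrite -opprD; exact: ReND.
Qed.

(** Half of the right-hand derivative cancels one of the two quadratic terms on the left, leaving
    the pairing of [c'' - c' c^-1 c'] with [Z]. *)
Lemma pd_geodesic_eqP c1 c t W Z :
  c t \in unitmx -> curve_derive c t (c1 t) -> curve_derive c1 t W ->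
  derive1 (fun s => pd_metric (c s) (c1 s) Z) t =
    2^-1 * derive1 (fun s : R => pd_metric (c t + s%:C *: Z) (c1 t) (c1 t)) 0
  <->
  complex.Re (\tr (invmx (c t) *m (W - c1 t *m invmx (c t) *m c1 t) *m
                   invmx (c t) *m Z)) = 0.
Proof.
move=> cu dc dc1; set I := invmx (c t).
have ReB (a b : C) : complex.Re (a - b) = complex.Re a - complex.Re b.
  by case: a b => [? ?] [? ?].
have -> := congr1 (@complex.Re R) (metric_acceleration I (c1 t) W Z).
rewrite ReB (pd_metric_derive Z cu dc dc1) (pd_metric_line_derive _ Z cu) -/I.
have key (a b : R) : a - 2 * b = 2^-1 * (- 2 * b) <-> a - b = 0.
  by split=> h; lra.
exact: key.
Qed.

Lemma curve_derive_herm c t V : (forall s, (c s)^t* = c s) ->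
  curve_derive c t V -> V^t* = V.
Proof.
move=> ch dc; apply: curve_derive_unique (dc).
by have := curve_derive_adj dc; under eq_fun do rewrite ch.
Qed.

(** On the diagonal, [k^2 e^(t k)] is [k e^(t k)] times [e^(- t k)] times [k e^(t k)], which is
    [c'' = c' c^-1 c']. *)
Lemma pd_geodesic_exp N (k : 'I_n -> R) : N \in unitmx ->
  is_pd_geodesic (fun s => N *m dg (fun i => expR (s * k i)) *m N^t*) /\
  curve_derive (fun s => N *m dg (fun i => expR (s * k i)) *m N^t*) 0
    (N *m dg k *m N^t*).
Proof.
move=> Nu.
have dNN (f : R -> 'I_n -> R) t (d : 'I_n -> R) :
    (forall i, is_derive t (1 : R) (f ^~ i) (d i)) ->
    curve_derive (fun s => N *m dg (f s) *m N^t*) t (N *m dg d *m N^t*).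
  move=> /curve_derive_dg fd.
  apply: curve_derive_eq (curve_deriveM (curve_deriveM
    (curve_derive_cst t N) fd) (curve_derive_cst t (N^t*))) _.
  by rewrite mul0mx add0r mulmx0 addr0.
have dexp t (a b : R) :
    is_derive t (1 : R) (fun s => a * expR (s * b)) (a * b * expR (t * b)).
  have dl : is_derive t (1 : R) (fun s => s * b) b.
    apply: is_derive_eq (is_derive_funM (is_derive_id _ _)
      (is_derive_cst _ _ _)) _.
    by rewrite mulr0 addr0 mul1r.
  apply: is_derive_eq (is_derive_funM (is_derive_cst a _ _)
    (is_derive1_comp (is_derive_expR _) dl)) _.
  by rewrite /= mul0r add0r; ring.
have dc t : curve_derive (fun s => N *m dg (fun i => expR (s * k i)) *m N^t*)
    t (N *m dg (fun i => k i * expR (t * k i)) *m N^t*).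
  apply: dNN => i; have := dexp t 1 (k i).
  by under eq_fun do rewrite mul1r; rewrite mul1r.
have dc1 t : curve_derive
    (fun s => N *m dg (fun i => k i * expR (s * k i)) *m N^t*)
    t (N *m dg (fun i => k i * k i * expR (t * k i)) *m N^t*).
  by apply: dNN => i; exact: dexp.
split; last first.
  apply: curve_derive_eq (dc 0) _; congr (_ *m _ *m _).
  by apply: eq_dg => i; rewrite mul0r expR0 mulr1.
have pd t : posdefmx (N *m dg (fun i => expR (t * k i)) *m N^t*).
  by apply: posdef_congr => // i; exact: expR_gt0.
split=> //.
exists (fun t => N *m dg (fun i => k i * expR (t * k i)) *m N^t*),
  (fun t => N *m dg (fun i => k i * k i * expR (t * k i)) *m N^t*).
split; [exact: dc|exact: dc1|].
move=> t Z _; apply/(pd_geodesic_eqP Z (posdef_unit (pd t)) (dc t) (dc1 t)).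
have e0 i : expR (t * k i) != 0 by rewrite gt_eqF ?expR_gt0.
have E : dg (fun i => k i * expR (t * k i)) *m
    dg (fun i => (expR (t * k i))^-1) *m dg (fun i => k i * expR (t * k i)) =
    dg (fun i => k i * k i * expR (t * k i)).
  by rewrite !dgM; apply: eq_dg => i; field.
have -> // := congr1 (@complex.Re R) (metric_acceleration0 _ _).
by rewrite (congr_acceleration _ Nu (dgVr e0)) E.
Qed.

(* The geodesic equation says [c2 = c1 c^-1 c1], so [c^-1 c1] is constant. *)
Lemma pd_geodesic_velocity c V : is_pd_geodesic c -> curve_derive c 0 V ->
  forall t, curve_derive c t (c t *m (invmx (c 0) *m V)).
Proof.
move=> [pc [c1 [c2 [dc dc1 geo]]]] dV.
have cu t : c t \in unitmx by exact: posdef_unit.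
have ch t : (c t)^t* = c t by exact: posdef_herm.
(* Nondegeneracy concerns Hermitian matrices, so velocity and acceleration are first shown
   Hermitian. *)
have c1h t : (c1 t)^t* = c1 t by exact: curve_derive_herm ch (dc t).
have c2h t : (c2 t)^t* = c2 t by exact: curve_derive_herm c1h (dc1 t).
have cih t : (invmx (c t))^t* = invmx (c t) by exact: herm_inv.
have c2E t : c2 t = c1 t *m invmx (c t) *m c1 t.
  apply/eqP; rewrite -subr_eq0; apply/eqP/(sandwich_eq0 (cu t)).
  apply: Retr_nondegenerate.
    apply/hermP/herm_sandwich => //; apply: herm_sub => //.
    exact: herm_sandwich.
  move=> Z Zh; apply/(pd_geodesic_eqP Z (cu t) (dc t) (dc1 t)).
  exact: geo.
have cst := @curve_derive_const (fun s => invmx (c s) *m c1 s).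
have {}cst s t : invmx (c s) *m c1 s = invmx (c t) *m c1 t.
  apply: cst => {s t} t.
  apply: curve_derive_eq
    (curve_deriveM (curve_derive_inv (dc t) (cu t)) (dc1 t)) _.
  by rewrite c2E velocity_variation.
move=> t; rewrite (curve_derive_unique dV (dc 0)) (cst 0 t).
by rewrite (mulKVmx (cu t)).
Qed.

(** Both curves solve [c' = c G] with the same constant [G = c(0)^-1 V], so [c e^-1] keeps its
    initial value [1]. *)
Lemma pd_geodesic_unique c e V : is_pd_geodesic c -> is_pd_geodesic e ->
  c 0 = e 0 -> curve_derive c 0 V -> curve_derive e 0 V ->
  forall t, c t = e t.
Proof.
move=> gc ge ce dc de.
have dct := pd_geodesic_velocity gc dc.
have det := pd_geodesic_velocity ge de.
have eu t : e t \in unitmx by case: ge => pe _; exact: posdef_unit.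
have cst := @curve_derive_const (fun s => c s *m invmx (e s)).
have {}cst s t : c s *m invmx (e s) = c t *m invmx (e t).
  apply: cst => {s t} t.
  apply: curve_derive_eq
    (curve_deriveM (dct t) (curve_derive_inv (det t) (eu t))) _.
  by rewrite ce ratio_variation.
move=> t; have := cst t 0; rewrite ce (mulmxV (eu 0)) => /(congr1 (mulmx^~ (e t))).
by rewrite mul1mx (mulmxKV (eu t)).
Qed.

Lemma expmxZ U (k : 'I_n -> R) (a : R) : U *m U^t* = 1%:M ->
  expmx (a%:C *: (U *m dg k *m U^t*)) =
  U *m dg (fun i => expR (a * k i)) *m U^t*.
Proof.
move=> UU; have -> : a%:C *: (U *m dg k *m U^t*) =
    U *m dg (fun i => a * k i) *m U^t*.
  rewrite scalemxAl scalemxAr; congr (_ *m _ *m _).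
  by apply/matrixP => i j; rewrite !mxE rmorphM/= mulrnAr.
by rewrite expmx_spectral.
Qed.

(** Uniqueness of the gradient and of the geodesic makes the step single-valued; the explicit
    geodesic [e] computes it. *)
Lemma riemannian_gradient_stepP S B T t : posdefmx S -> posdefmx B ->
  riemannian_gradient_step (output_cost B) t S T <->
  T = sqrtmx S *m expmx ((2 * t)%:C *:
        lnmx (invsqrtmx S *m B *m invsqrtmx S)) *m sqrtmx S.
Proof.
move=> pS pB; have [N [x [Nu x0 SE BE]]] := simultaneous_congr pS pB.
have [pH HH] := sqrtmxP pS; have Hh := posdef_herm pH.
have := ln_ratio Nu x0; rewrite -SE -BE => -[U [UU HU ->]].
set H := sqrtmx S in pH HH Hh HU *.
(* Since [M M^* = S], the curve [M e^(t k) M^*] starts at [S]; this [k] makes its velocity there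
   minus the gradient. *)
pose k i := - 2 * ln (x i); pose M := H *m U.
have Mu : M \in unitmx by rewrite unitmx_mul (posdef_unit pH) unitary_unit.
have [geo vel] := pd_geodesic_exp k Mu.
set e := (fun s => _) in geo vel.
have e0 : e 0 = S.
  rewrite /e (_ : dg _ = 1%:M); last first.
    by rewrite -dg1; apply: eq_dg => i; rewrite mul0r expR0.
  by rewrite mulmx1 (congr_unitary H UU) Hh.
have eE : e t = H *m expmx ((2 * t)%:C *:
    (U *m dg (fun i => - ln (x i)) *m U^t*)) *m H.
  have ek : dg (fun i => expR (2 * t * - ln (x i))) =
      dg (fun i => expR (t * k i)).
    by apply: eq_dg => i; congr expR; rewrite /k; ring.
  rewrite (expmxZ _ _ UU) ek.
  by have := congr_comp H U (dg (fun i => expR (t * k i))); rewrite Hh => ->.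
have := pd_gradient_congr Nu x0; rewrite -SE -BE.
set V := _ *m _ *m _ => gradV.
(* As [M = N x^(1/2)], the left side is [N (x k) N^*]. *)
have VE : M *m dg k *m M^t* = - V.
  rewrite /M HU.
  apply: etrans (esym (congr_comp N (dg (fun i => Num.sqrt (x i))) (dg k))) _.
  rewrite dg_adj !dgM -congr_opp; congr (_ *m _ *m _).
  apply/matrixP => i j; rewrite !mxE -mulNrn -rmorphN; congr (_%:C *+ _).
  have rr : Num.sqrt (x i) * Num.sqrt (x i) = x i.
    by rewrite -expr2 sqr_sqrtr// ltW.
  by rewrite mulrAC rr /k; ring.
rewrite VE in vel; split.
  move=> [V' [c [gradV' gc c0 dc ->]]].
  rewrite (pd_gradient_unique pS gradV' gradV) in dc.
  have ce0 : c 0 = e 0 by rewrite c0 e0.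
  by rewrite -eE; exact: pd_geodesic_unique gc geo ce0 dc vel t.
by move=> ->; exists V, e; split.
Qed.
End Geodesics.

(* With L = ln(A^(-1/2) B A^(-1/2)), the gradient of d^2(., B) at A is
   -2 A^(1/2) L A^(1/2), so exp(- eta L) is reached at geodesic time - eta / 2
   along the negative gradient: with the sign written in the formula, genuine
   descent steps are those with eta k < 0. *)
Theorem theorem3p1 (R : realType) (m n : nat) (Theta : set 'rV[R]_m)
    (A : 'rV[R]_m -> 'M[R[i]]_n) (B : 'M[R[i]]_n)
    (hA : output_system Theta A) (hB : (A @` Theta) B)
    (eta : nat -> R) (u : nat -> 'rV[R]_m) (hu : forall k, Theta (u k)) :
  riemannian_gradient_descent A B (fun k => - eta k / 2) u <->
  forall k : nat,
    A (u k.+1) =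
      sqrtmx (A (u k))
      *m expmx (- (eta k)%:C *:
                lnmx (invsqrtmx (A (u k)) *m B *m invsqrtmx (A (u k))))
      *m sqrtmx (A (u k)).
Proof.
have [_ pA _ _ _] := hA.
have pB : posdefmx B by case: hB => v /pA ? <-.
have tE k : - (eta k)%:C = (2 * (- eta k / 2))%:C :> R[i].
  by rewrite mulrC divfK ?pnatr_eq0// rmorphN.
split=> step k; have stepP := riemannian_gradient_stepP (A (u k.+1))
    (- eta k / 2) (pA _ (hu k)) pB.
  by rewrite tE; apply/stepP; exact: step.
by apply/stepP; rewrite -tE; exact: step.
Qed.
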